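(* Let $\mathcal{M}=(X,rk,m)$ be an arithmetic matroid with underlying matroid $M=(X,rk)$. Then $$\mathcal{Z}_{\mathcal{M}}(pq,\mathbf{uv})=\sum_{T\subseteq X}p^{-rk(T)}\Big(\prod_{e\in T}(-u_e)\Big)\,\mathcal{Z}_{\mathcal{M}|T}(q,-\mathbf{v})\,Z_{M/T}(p,\mathbf{u})$$ and $$\mathcal{Z}_{\mathcal{M}}(pq,\mathbf{uv})=\sum_{T\subseteq X}p^{-rk(T)}\Big(\prod_{e\in T}(-u_e)\Big)\,Z_{M|T}(q,-\mathbf{v})\,\mathcal{Z}_{\mathcal{M}/T}(p,\mathbf{u}).$$
   Context: A matroid $(X,rk)$ is given by a finite ground set $X$ and its rank function $rk$. A multiplicity matroid is a triple $\mathcal{M}=(X,rk,m)$ where $(X,rk)$ is a matroid and $m:2^X\to\mathbb{Z}_{>0}$ is any function. It is an arithmetic matroid if $m$ satisfies: (1) for all $A\subseteq X$ and $e\in X$: if $rk(A\cup\{e\})=rk(A)$ then $m(A\cup\{e\})$ divides $m(A)$; otherwise $m(A)$ divides $m(A\cup\{e\})$; (2) if $A\subseteq B\subseteq X$ and $B$ is a disjoint union $B=A\cup F\cup T$ such that $rk(C)=rk(A)+|C\cap F|$ for all $A\subseteq C\subseteq B$, then $m(A)m(B)=m(A\cup F)m(A\cup T)$; (3) if $A\subseteq B\subseteq X$ and $rk(A)=rk(B)$, then $\sum_{A\subseteq T\subseteq B}(-1)^{|T|-|A|}m(T)\ge 0$; (4) if $A\subseteq B\subseteq X$ and $rk^*(A)=rk^*(B)$,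 then $\sum_{A\subseteq T\subseteq B}(-1)^{|T|-|A|}m(X\setminus T)\ge 0$, where $rk^*(A)=|A|+rk(X\setminus A)-rk(X)$. For $T\subseteq X$, the restriction $\mathcal{M}|T$ is the multiplicity matroid on $T$ obtained by restricting $rk$ and $m$ to subsets of $T$. The contraction $\mathcal{M}/T$ is the multiplicity matroid on $X\setminus T$ with $rk_{\mathcal{M}/T}(A)=rk(A\cup T)-rk(T)$ and $m_{\mathcal{M}/T}(A)=m(A\cup T)$ for $A\subseteq X\setminus T$. $M|T$ and $M/T$ are the usual matroid restriction and contraction, i.e. the underlying matroids of $\mathcal{M}|T$ and $\mathcal{M}/T$. Let $p,q$ and $u_e,v_e$ ($e\in X$) be commuting variables. The multivariate arithmetic Tutte polynomial of $\mathcal{M}$ and the multivariate Tutte polynomial of $M$ are $$\mathcal{Z}_{\mathcal{M}}(q,\mathbf{v})=\sum_{A\subseteq X}m(A)\,q^{-rk(A)}\prod_{e\in A}v_e,\qquad Z_{M}(q,\mathbf{v})=\sum_{A\subseteq X}q^{-rk(A)}\prod_{e\in A}v_e .$$ Here $\mathbf{v}=\{v_e:e\in X\}$, $\mathbf{u}=\{u_e:e\in X\}$, $\mathbf{uv}=\{u_ev_e:e\in X\}$, $-\mathbf{v}=\{-v_e:e\in X\}$. For a restriction or contraction, the same formulas are used with its own ground set, rank function and (if present) multiplicity, and only the variables indexed by elements of its ground set are used. *)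

(* Defs.v *)
From HB Require Import structures.
From mathcomp Require Import all_boot all_order all_algebra.

Set Implicit Arguments.
Unset Strict Implicit.
Unset Printing Implicit Defensive.

Import Order.TTheory GRing.Theory Num.Theory.
Local Open Scope ring_scope.

(* The ground set is the whole finite type [X]; minors live on the finite
   subtypes [elts T]. *)
Record matroid (X : finType) := Matroid {
  rk : {set X} -> nat;
  rk_le_card : forall A : {set X}, (rk A <= #|A|)%N;
  rk_mono : forall A B : {set X}, A \subset B -> (rk A <= rk B)%N;
  rk_submod : forall A B : {set X},
    (rk (A :|: B) + rk (A :&: B) <= rk A + rk B)%N
}.

Record mult_matroid (X : finType) := MultMatroid {
  underlying :> matroid X;
  mult : {set X} -> nat;
  mult_gt0 : forall A : {set X}, (0 < mult A)%N
}.

(* Truncated subtraction is harmless: rk X <= rk (~: A) + rk A <= rk (~: A) + #|A|. *)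
Definition corank (X : finType) (M : matroid X) (A : {set X}) : nat :=
  (#|A| + rk M (~: A) - rk M [set: X])%N.

Record arithmetic (X : finType) (M : mult_matroid X) : Prop := Arithmetic {
  arith_div : forall (A : {set X}) (e : X),
    if rk M (A :|: [set e]) == rk M A
    then (mult M (A :|: [set e]) %| mult M A)%N
    else (mult M A %| mult M (A :|: [set e]))%N;
  arith_molecule : forall A B F T : {set X},
    A \subset B ->
    B = A :|: F :|: T ->
    [disjoint A & F] -> [disjoint A & T] -> [disjoint F & T] ->
    (forall C : {set X}, A \subset C -> C \subset B ->
       rk M C = (rk M A + #|C :&: F|)%N) ->
    (mult M A * mult M B = mult M (A :|: F) * mult M (A :|: T))%N;
  arith_pos : forall A B : {set X},
    A \subset B -> rk M A = rk M B ->
    0 <= \sum_(T : {set X} | (A \subset T) && (T \subset B))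
           (-1) ^+ (#|T| - #|A|) * (mult M T)%:Z;
  arith_copos : forall A B : {set X},
    A \subset B -> corank M A = corank M B ->
    0 <= \sum_(T : {set X} | (A \subset T) && (T \subset B))
           (-1) ^+ (#|T| - #|A|) * (mult M (~: T))%:Z
}.

Definition elts (X : finType) (T : {set X}) : finType := {x : X | x \in T}.

Definition emb (X : finType) (T : {set X}) (A : {set elts T}) : {set X} :=
  [set val x | x in A].

Section Minors.
Variables (X : finType) (T : {set X}).
Implicit Types A B : {set elts T}.

Lemma card_emb A : #|emb A| = #|A|.
Proof. exact/card_imset/val_inj. Qed.

Lemma embU A B : emb (A :|: B) = emb A :|: emb B.
Proof. exact: imsetU. Qed.

Lemma embI A B : emb (A :&: B) = emb A :&: emb B.
Proof. by apply: imsetI => x y _ _; apply: val_inj. Qed.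

End Minors.

Section Restriction.
Variables (X : finType) (M : matroid X) (T : {set X}).

Definition restr_rk (A : {set elts T}) : nat := rk M (emb A).

Lemma restr_rk_le_card A : (restr_rk A <= #|A|)%N.
Proof. by rewrite -card_emb rk_le_card. Qed.

Lemma restr_rk_mono (A B : {set elts T}) :
  A \subset B -> (restr_rk A <= restr_rk B)%N.
Proof. by move=> sAB; apply/rk_mono/imsetS. Qed.

Lemma restr_rk_submod A B :
  (restr_rk (A :|: B) + restr_rk (A :&: B) <= restr_rk A + restr_rk B)%N.
Proof. by rewrite /restr_rk embU embI rk_submod. Qed.

Definition restr : matroid (elts T) :=
  Matroid restr_rk_le_card restr_rk_mono restr_rk_submod.

End Restriction.

Section Contraction.
Variables (X : finType) (M : matroid X) (T : {set X}).

Definition contr_rk (A : {set elts (~: T)}) : nat :=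
  (rk M (emb A :|: T) - rk M T)%N.

Lemma rk_leUr (A : {set X}) : (rk M T <= rk M (A :|: T))%N.
Proof. by apply/rk_mono/subsetUr. Qed.

Lemma contr_rk_le_card A : (contr_rk A <= #|A|)%N.
Proof.
rewrite leq_subLR -card_emb addnC.
apply: leq_trans (leq_add (rk_le_card M (emb A)) (leqnn _)).
exact: leq_trans (leq_addr _ _) (rk_submod _ _ _).
Qed.

Lemma contr_rk_mono (A B : {set elts (~: T)}) :
  A \subset B -> (contr_rk A <= contr_rk B)%N.
Proof. by move=> sAB; apply/leq_sub2r/rk_mono/setSU/imsetS. Qed.

Lemma contr_rk_submod A B :
  (contr_rk (A :|: B) + contr_rk (A :&: B) <= contr_rk A + contr_rk B)%N.
Proof.
rewrite -(leq_add2r (rk M T + rk M T)) addnACA [leqRHS]addnACA.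
rewrite /contr_rk !subnK ?rk_leUr //.
by rewrite embU embI setUIl setUUl rk_submod.
Qed.

Definition contr : matroid (elts (~: T)) :=
  Matroid contr_rk_le_card contr_rk_mono contr_rk_submod.

End Contraction.

Definition mrestr (X : finType) (M : mult_matroid X) (T : {set X}) :
    mult_matroid (elts T) :=
  @MultMatroid _ (restr M T) (fun A => mult M (emb A))
    (fun A => mult_gt0 M (emb A)).

Definition mcontr (X : finType) (M : mult_matroid X) (T : {set X}) :
    mult_matroid (elts (~: T)) :=
  @MultMatroid _ (contr M T) (fun A => mult M (emb A :|: T))
    (fun A => mult_gt0 M (emb A :|: T)).

(* The variables are arbitrary elements of a commutative ring; [q] has to be
   a unit for [q ^- rk M A] to be the negative power. *)
Definition tutte (X : finType) (M : matroid X) (R : comUnitRingType)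
    (q : R) (v : X -> R) : R :=
  \sum_(A : {set X}) q ^- rk M A * \prod_(e in A) v e.

Definition arith_tutte (X : finType) (M : mult_matroid X) (R : comUnitRingType)
    (q : R) (v : X -> R) : R :=
  \sum_(A : {set X}) (mult M A)%:R * q ^- rk M A * \prod_(e in A) v e.

(* Main.v *)
Require Import Defs.
From HB Require Import structures.
From mathcomp Require Import all_boot all_order all_algebra ring.

Set Implicit Arguments.
Unset Strict Implicit.
Unset Printing Implicit Defensive.

Import Order.TTheory GRing.Theory Num.Theory.
Local Open Scope ring_scope.

(** Moving [p ^- rk T] and the factor [\prod_(e in T) u e] into the
    contraction turns its terms into those of [M] indexed by the sets [B]
    containing [T]: the exponent [rk_(M/T)] telescopes, and the missing
    variables [u e] are restored.  The terms of the restriction are those of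
    [M] indexed by the subsets [A] of [T].  The right-hand side is thus a sum
    over all chains [A \subset T \subset B], in which [T] only occurs through
    the sign [(-1) ^+ #|T|]; by Moebius inversion on the Boolean lattice
    (lemma [sum_sign_interval]) only the terms with [A = B] remain, which are
    those of the left-hand side, the signs of [- u] and [- v] cancelling.

    The argument allows an arbitrary weight on the sets [A] and another one
    on the sets [B] (lemma [weighted_convolution]).  The two formulas are the
    cases where one weight is the multiplicity and the other is [1]. *)

(** The sum is the expansion of a product of factors [f e + g e], where the
    term [f e = -1] for [e \in T] is present only if [e \in B], and the term
    [g e = 1] for [e \notin T] only if [e \notin A].  A factor vanishes as soon
    as [A] and [B] differ at [e]: its two terms are then absent, or cancel. *)
Lemma sum_sign_interval (X : finType) (R : comNzRingType) (A B : {set X}) :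
  \sum_(T : {set X} | (A \subset T) && (T \subset B)) (-1) ^+ #|T| =
    (if A == B then (-1) ^+ #|A| else 0) :> R.
Proof.
pose f e : R := if e \in B then -1 else 0.
pose g e : R := if e \in A then 0 else 1.
transitivity (\prod_e (f e + g e)).
  rewrite bigA_distr [LHS]big_mkcond /=; apply: eq_bigr => T _.
  have [/subsetP sAT|/subsetPn[e eA eT]] /= := boolP (A \subset T); last first.
    by rewrite (bigD1 e) //= (negbTE eT) /g eA mul0r.
  have [/subsetP sTB|/subsetPn[e eT eB]] /= := boolP (T \subset B); last first.
    by rewrite (bigD1 e) //= eT /f (negbTE eB) mul0r.
  rewrite -prodr_const [LHS]big_mkcond /=; apply: eq_bigr => e _.
  have [eT|eT] := boolP (e \in T); first by rewrite /f sTB.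
  by rewrite /g ifN //; apply: contra eT; apply: sAT.
have [eqAB|neqAB] := eqVneq A B.
  rewrite -prodr_const [RHS]big_mkcond /=; apply: eq_bigr => e _.
  by rewrite /f /g eqAB; case: ifP => _; rewrite ?addr0 ?add0r.
have [e neqe] : exists e, (e \in A) != (e \in B).
  apply/existsP; apply: contraNT neqAB => /existsPn eqAB.
  by apply/eqP/setP => e; apply/eqP; rewrite -[_ == _]negbK eqAB.
rewrite (bigD1 e) //= /f /g; move: neqe.
by case: (e \in A); case: (e \in B) => // _; rewrite ?addr0 ?addNr mul0r.
Qed.

(** Exchanging the sums leaves an alternating sum over each interval
    [[A, B]], which is concentrated on the diagonal. *)
Lemma sum_sign_convolution (X : finType) (R : comNzRingType)
    (F G : {set X} -> R) :
  \sum_(T : {set X}) (-1) ^+ #|T| *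
     (\sum_(A : {set X} | A \subset T) F A) *
     (\sum_(B : {set X} | T \subset B) G B) =
  \sum_(A : {set X}) (-1) ^+ #|A| * F A * G A.
Proof.
transitivity (\sum_(A : {set X}) \sum_(B : {set X})
    (\sum_(T : {set X} | (A \subset T) && (T \subset B)) (-1) ^+ #|T|)
    * F A * G B).
  transitivity (\sum_(T : {set X}) \sum_(A : {set X}) \sum_(B : {set X})
      (if (A \subset T) && (T \subset B) then (-1) ^+ #|T| else 0)
      * F A * G B).
    apply: eq_bigr => T _; rewrite -mulrA mulr_suml mulr_sumr big_mkcond /=.
    apply: eq_bigr => A _; case: ifP => _ /=; last first.
      by rewrite big1 // => B _; rewrite !mul0r.
    rewrite mulrA mulr_sumr big_mkcond /=; apply: eq_bigr => B _.
    by case: ifP => _ //; rewrite !mul0r.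
  rewrite exchange_big; apply: eq_bigr => A _ /=.
  rewrite exchange_big; apply: eq_bigr => B _ /=.
  by rewrite !mulr_suml [RHS]big_mkcond; apply: eq_bigr => T _ /=;
    case: ifP => _ //; rewrite !mul0r.
apply: eq_bigr => A _; rewrite (bigD1 A) //= sum_sign_interval eqxx.
rewrite big1 ?addr0 // => B neqBA.
by rewrite sum_sign_interval eq_sym (negbTE neqBA) !mul0r.
Qed.

Section Embedding.

Variables (X : finType) (T : {set X}).

Lemma emb_sub (A : {set elts T}) : emb A \subset T.
Proof. by apply/subsetP => _ /imsetP[x _ ->]; apply: valP. Qed.

Lemma emb_preim (A : {set X}) :
  A \subset T -> emb (val @^-1: A : {set elts T}) = A.
Proof.
move=> /subsetP sAT; apply/setP => x; apply/imsetP/idP => [[y]|xA].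
  by rewrite inE => yA ->.
by exists (Sub x (sAT x xA)); rewrite ?inE SubK.
Qed.

Lemma preim_emb (A : {set elts T}) : val @^-1: emb A = A.
Proof. by apply/setP => x; rewrite inE mem_imset //; apply: val_inj. Qed.

Lemma prod_emb (R : comNzRingType) (f : X -> R) (A : {set elts T}) :
  \prod_(e in A) f (val e) = \prod_(e in emb A) f e.
Proof. by rewrite /emb big_imset //= => x y _ _; apply: val_inj. Qed.

Lemma sum_emb (V : nmodType) (F : {set X} -> V) :
  \sum_(A : {set elts T}) F (emb A) = \sum_(A : {set X} | A \subset T) F A.
Proof.
rewrite [RHS](reindex_onto (@emb X T) (fun A => val @^-1: A)) /=; last first.
  by move=> A; apply: emb_preim.
by apply: eq_bigl => A; rewrite emb_sub preim_emb eqxx.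
Qed.

End Embedding.

Lemma sum_embU (X : finType) (T : {set X}) (V : nmodType) (F : {set X} -> V) :
  \sum_(B : {set elts (~: T)}) F (emb B :|: T) =
    \sum_(B : {set X} | T \subset B) F B.
Proof.
rewrite (sum_emb _ (fun B => F (B :|: T))).
rewrite [RHS](reindex_onto (fun B : {set X} => B :|: T) (fun B => B :\: T)) /=; last first.
  by move=> B sTB; rewrite setUC -{2}(setID B T) (setIidPr sTB).
apply: eq_bigl => B; rewrite subsetUr setDUl setDv setU0 /=.
by rewrite -disjoints_subset; apply/idP/eqP => /setDidPl.
Qed.

(** The rank of the contraction is a difference of two ranks of [M], so that
    the factor [p ^- rk M T] is exactly what is missing. *)
Lemma contr_term (X : finType) (M : matroid X) (R : comUnitRingType) (p : R)
    (u : X -> R) (T : {set X}) (B : {set elts (~: T)}) :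
    p \is a GRing.unit ->
  p ^- rk M T * (\prod_(e in T) u e) *
     (p ^- rk (contr M T) B * \prod_(e in B) u (val e)) =
  p ^- rk M (emb B :|: T) * \prod_(e in emb B :|: T) u e.
Proof.
move=> up; rewrite mulrACA; congr (_ * _).
  by rewrite -!exprVn -exprD /= subnKC // rk_leUr.
rewrite prod_emb mulrC -bigU ?disjoints_subset ?emb_sub //=.
by apply: eq_bigl => e; rewrite !inE.
Qed.

(** Only the products [a A * b A] survive the inversion, so a weight may be
    put on either side, or split between the two. *)
Lemma weighted_convolution (X : finType) (M : matroid X) (R : comUnitRingType)
    (p q : R) (u v : X -> R) (a b : {set X} -> R) :
    p \is a GRing.unit -> q \is a GRing.unit ->
  \sum_(A : {set X}) a A * b A * (p * q) ^- rk M A * \prod_(e in A) (u e * v e) =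
  \sum_(T : {set X})
    p ^- rk M T * (\prod_(e in T) - u e)
    * (\sum_(A : {set elts T})
         a (emb A) * q ^- rk (restr M T) A * \prod_(e in A) - v (val e))
    * (\sum_(B : {set elts (~: T)})
         b (emb B :|: T) * p ^- rk (contr M T) B * \prod_(e in B) u (val e)).
Proof.
move=> up uq.
pose F A := a A * q ^- rk M A * \prod_(e in A) - v e.
pose G B := b B * (p ^- rk M B * \prod_(e in B) u e).
transitivity (\sum_(A : {set X}) (-1) ^+ #|A| * F A * G A).
  (* The sign of the Moebius inversion cancels the one hidden in [- v]. *)
  apply: eq_bigr => A _; rewrite /F /G prodrN big_split /= exprMn invrM ?unitrX //.
  have sgn2 : (-1) ^+ #|A| * (-1) ^+ #|A| = 1 :> R by rewrite -expr2 sqrr_sign.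
  by rewrite -[LHS]mul1r -[X in X * _ = _]sgn2; ring.
rewrite -sum_sign_convolution; apply: eq_bigr => T _.
rewrite prodrN mulrCA -!mulrA; congr (_ * _).
rewrite -(sum_emb _ F) -(sum_embU _ G) [RHS]mulrA mulrCA.
congr (_ * _); first by apply: eq_bigr => A _; rewrite /F -(prod_emb (fun e => - v e)).
rewrite mulr_sumr; apply: eq_bigr => B _.
by rewrite /G -contr_term // mulrCA !mulrA.
Qed.

Theorem corollary2p3 (X : finType) (M : mult_matroid X) (hM : arithmetic M)
    (R : comUnitRingType) (p q : R) (u v : X -> R)
    (hp : p \is a GRing.unit) (hq : q \is a GRing.unit) :
  arith_tutte M (p * q) (fun e => u e * v e) =
    \sum_(T : {set X})
      p ^- rk M T * (\prod_(e in T) - u e)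
      * arith_tutte (mrestr M T) q (fun e : elts T => - v (val e))
      * tutte (contr M T) p (fun e : elts (~: T) => u (val e))
  /\
  arith_tutte M (p * q) (fun e => u e * v e) =
    \sum_(T : {set X})
      p ^- rk M T * (\prod_(e in T) - u e)
      * tutte (restr M T) q (fun e : elts T => - v (val e))
      * arith_tutte (mcontr M T) p (fun e : elts (~: T) => u (val e)).
Proof.
pose m A : R := (mult M A)%:R; pose one (A : {set X}) : R := 1.
split.
  transitivity (\sum_(A : {set X})
      m A * one A * (p * q) ^- rk M A * \prod_(e in A) (u e * v e)).
    by apply: eq_bigr => A _; rewrite mulr1.
  rewrite weighted_convolution //; apply: eq_bigr => T _; congr (_ * _).
  by apply: eq_bigr => B _; rewrite mul1r.
transitivity (\sum_(A : {set X})
    one A * m A * (p * q) ^- rk M A * \prod_(e in A) (u e * v e)).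
  by apply: eq_bigr => A _; rewrite mul1r.
rewrite weighted_convolution //; apply: eq_bigr => T _; congr (_ * _ * _).
by apply: eq_bigr => A _; rewrite mul1r.
Qed.
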